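(* Let $\mathcal{A}=\{\mathbf a_1,\dots,\mathbf a_n\}\subset\mathbb N^m$, let $A\in\mathcal M_{m\times n}(\mathbb N)$ be the matrix with columns $\mathbf a_1,\dots,\mathbf a_n$, let $\mathcal L(\mathcal A)=\operatorname{Ker}_{\mathbb Z}(A)\subset\mathbb Z^n$, and assume $\mathcal L(\mathcal A)\cap\mathbb N^n=\{\mathbf 0\}$. Then the indispensable part $\mathcal S(\mathcal A)$ of the universal Markov basis of $\mathcal A$ consists of all nonzero vectors in $\mathcal L(\mathcal A)$ which have no proper semiconformal decomposition.
   Context: $\mathbb N$ contains $0$. For $\mathbf u\in\mathbb Z^n$, $\mathbf u^+,\mathbf u^-\in\mathbb N^n$ are the unique vectors with disjoint supports such that $\mathbf u=\mathbf u^+-\mathbf u^-$. A Markov basis of $\mathcal A$ is a finite subset $\mathcal M\subset\mathcal L(\mathcal A)$ such that for all $\mathbf w,\mathbf u\in\mathbb N^n$ with $\mathbf w-\mathbf u\in\mathcal L(\mathcal A)$ there is a finite (possibly empty) sequence $\mathbf v_1,\dots,\mathbf v_s$ with $\mathbf v_i\in\mathcal M$ or $-\mathbf v_i\in\mathcal M$ for each $i$, such that $\mathbf w-\mathbf u=\sum_{i=1}^s\mathbf v_i$ and $\mathbf w-\sum_{i=1}^p\mathbf v_i\in\mathbb N^n$ for all $1\le p\le s$. It is minimal if no proper subset of it is a Markov basis of $\mathcal A$. The universal Markov basis $\mathcal M(\mathcal A)$ is the union of all minimal Markov bases of $\mathcal A$, and $\mathcal S(\mathcal A)$ (the indispensable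 subset) is the intersection of all minimal Markov bases of $\mathcal A$; in both cases vectors that differ only by a sign are identified. Semiconformal decomposition: for $\mathbf u,\mathbf v,\mathbf w\in\mathcal L(\mathcal A)$, $\mathbf u=\mathbf v+_{sc}\mathbf w$ is a semiconformal decomposition of $\mathbf u$ if $\mathbf u=\mathbf v+\mathbf w$ and for every coordinate $i$: $\mathbf v(i)>0$ implies $\mathbf w(i)\ge 0$, and $\mathbf w(i)<0$ implies $\mathbf v(i)\le 0$. (The order of the summands matters.) It is proper if both $\mathbf v$ and $\mathbf w$ are nonzero. The property of having a proper semiconformal decomposition is invariant under $\mathbf u\mapsto-\mathbf u$. *)

(* Defs.v *)
From mathcomp Require Import all_boot all_order all_algebra.
From mathcomp Require Import finmap.
Set Implicit Arguments.
Unset Strict Implicit.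
Unset Printing Implicit Defensive.
Import Order.TTheory GRing.Theory Num.Theory.
Local Open Scope ring_scope.

Section MarkovBases.
Variables (m n : nat) (A : 'M[nat]_(m, n)).
Implicit Types (u v w : 'cV[int]_n) (M : {fset 'cV[int]_n}).

(* Ker_Z(A); the vectors a_1, ..., a_n are the columns of A. *)
Definition lattice : {pred 'cV[int]_n} :=
  [pred u | map_mx Posz A *m u == 0].

(* Membership of an integer vector in N^n. *)
Definition nonneg (u : 'cV[int]_n) : Prop := forall i, 0 <= u i 0.

Definition markov_basis (M : {fset 'cV[int]_n}) : Prop :=
  {subset M <= lattice} /\
  forall w u, nonneg w -> nonneg u -> w - u \in lattice ->
    exists vs : seq 'cV[int]_n,
      [/\ forall v, v \in vs -> v \in M \/ - v \in M,
          w - u = \sum_(v <- vs) v &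
          forall p, (1 <= p <= size vs)%N ->
            nonneg (w - \sum_(v <- take p vs) v)].

Definition minimal_markov_basis (M : {fset 'cV[int]_n}) : Prop :=
  markov_basis M /\
  forall M', (M' `<` M)%fset -> ~ markov_basis M'.

(* The intersection is taken up to sign: instead of choosing representatives
   of the pairs {u, -u}, we take the sign-symmetric set they form. *)
Definition indispensable u : Prop :=
  forall M, minimal_markov_basis M -> u \in M \/ - u \in M.

Definition semiconformal_decomp u v w : Prop :=
  [/\ u \in lattice, v \in lattice, w \in lattice, u = v + w &
      forall i, (0 < v i 0 -> 0 <= w i 0) /\ (w i 0 < 0 -> v i 0 <= 0)].

Definition has_proper_semiconformal_decomp u : Prop :=
  exists v w, [/\ semiconformal_decomp u v w, v != 0 & w != 0].

End MarkovBases.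

(* Main.v *)
Require Import Defs.
From mathcomp Require Import all_boot all_order all_algebra.
From mathcomp Require Import finmap.
From mathcomp Require Import zify.
From Stdlib Require Import Classical.
Set Implicit Arguments.
Unset Strict Implicit.
Unset Printing Implicit Defensive.
Import Order.TTheory GRing.Theory Num.Theory.
Local Open Scope ring_scope.

(** Say that a vector [v] is a move of [M] when [v] or [- v] lies in [M].

    If [u] is nonzero and has no proper semiconformal decomposition, then every
    Markov basis connects the positive part of [u] to its negative part; the
    first nonzero move [v] of such a path is bounded above by the positive part
    of [u], which says exactly that [u = v + (u - v)] is semiconformal.  Hence
    [v = u], and [u] is a move of every Markov basis.

    Conversely, suppose [u = v + w] is a proper semiconformal decomposition.
    Semiconformality means that whenever [x] and [x - u] are nonnegative, so is
    [x - v] ([semiconformal_detour]): the move [u] can always be replaced by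
    [v] followed by [w].  Pointedness excludes [v = - u] and [w = - u], so
    replacing [u] and [- u] by [v] and [w] in a Markov basis gives a Markov
    basis avoiding [u] up to sign ([markov_basis_replace]), which then contains
    a minimal one ([minimal_markov_basis_sub]).  The vector [0] is avoided in
    the same way, its move being replaced by the empty path.  This argument
    needs a Markov basis to start from; existence follows from Dickson's lemma
    ([markov_basis_exists]). *)

(** * Dickson's lemma *)

(** Dickson's lemma, for a family of measures [c i] on an arbitrary type: with
    [T] the set of vectors and [c i] the coordinates this is the usual
    statement.  Allowing any [T] makes the induction on the number of measures
    immediate: a basis [F] for the other measures serves all points where the
    new measure is at least its maximum [B] on [F], and each of the finitely
    many levels below [B] is handled by the induction hypothesis. *)
Lemma dickson (I T : eqType) (c : I -> T -> nat) (s : seq I) (P : T -> Prop) :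
  exists F : seq T, (forall f, f \in F -> P f) /\
    forall x, P x ->
      exists2 f, f \in F & forall i, i \in s -> (c i f <= c i x)%N.
Proof.
elim: s P => [|i s IHs] P.
  case: (classic (exists x, P x)) => [[x Px]|noP].
    exists [:: x]; split=> [f|y _]; first by rewrite inE => /eqP->.
    by exists x; rewrite ?inE.
  by exists [::]; split=> // x Px; case: noP; exists x.
have [F [FP Fdom]] := IHs P.
pose B := \max_(f <- F) c i f.
have [G [GP Gdom]] : exists G : seq T, (forall f, f \in G -> P f) /\
    forall x, P x -> (c i x < B)%N ->
      exists2 f, f \in G & forall j, j \in i :: s -> (c j f <= c j x)%N.
  elim: B => [|b [G [GP Gdom]]]; first by exists [::].
  have [H [HP Hdom]] := IHs (fun x => P x /\ c i x = b).
  exists (H ++ G); split=> [f|x Px].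
    by rewrite mem_cat => /orP[/HP[]|/GP].
  rewrite ltnS leq_eqVlt => /orP[/eqP cx|/(Gdom x Px)[f Gf le_fx]].
    have [f Hf le_fx] := Hdom x (conj Px cx).
    exists f => [|j]; first by rewrite mem_cat Hf.
    rewrite inE => /predU1P[->|/le_fx//].
    by have [_ ->] := HP f Hf; rewrite cx.
  by exists f => //; rewrite mem_cat Gf orbT.
exists (F ++ G); split=> [f|x Px]; first by rewrite mem_cat => /orP[/FP|/GP].
have [/(Gdom x Px)[f Gf le_fx]|le_Bx] := ltnP (c i x) B.
  by exists f => //; rewrite mem_cat Gf orbT.
have [f Ff le_fx] := Fdom x Px.
exists f => [|j]; first by rewrite mem_cat Ff.
rewrite inE => /predU1P[->|/le_fx//].
by apply: leq_trans le_Bx; apply: leq_bigmax_seq.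
Qed.

(** * Integer vectors *)

(** Unlike [mxE], these leave the entries at type [int] itself, so that linear
    arithmetic recognises all occurrences of an entry as the same unknown. *)
Lemma coordN n (u : 'cV[int]_n) i : (- u) i 0 = - u i 0.
Proof. by rewrite mxE. Qed.

Lemma coordD n (u v : 'cV[int]_n) i : (u + v) i 0 = u i 0 + v i 0.
Proof. by rewrite mxE. Qed.

Lemma coordP n (u v : 'cV[int]_n) : u = v <-> forall i, u i 0 = v i 0.
Proof. by split=> [->//|/colP]. Qed.

Definition coordE := (coordD, coordN).

Section MarkovBasisTheory.
Variables (m n : nat) (A : 'M[nat]_(m, n)).
Implicit Types (u v w x y : 'cV[int]_n) (M : {fset 'cV[int]_n}).

Lemma latticeB u v : u \in lattice A -> v \in lattice A -> u - v \in lattice A.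
Proof. by rewrite !inE mulmxBr => /eqP-> /eqP->; rewrite subr0. Qed.

Lemma latticeN u : (- u \in lattice A) = (u \in lattice A).
Proof. by rewrite !inE mulmxN oppr_eq0. Qed.

Lemma nonneg_add u v : nonneg u -> nonneg v -> nonneg (u + v).
Proof. by move=> u0 v0 i; rewrite mxE addr_ge0. Qed.

(** * Paths *)

Definition is_move M v : Prop := v \in M \/ - v \in M.

Definition connected M w u : Prop :=
  exists vs : seq 'cV[int]_n,
    [/\ forall v, v \in vs -> is_move M v,
        w - u = \sum_(v <- vs) v &
        forall p, (1 <= p <= size vs)%N ->
          nonneg (w - \sum_(v <- take p vs) v)].

Lemma connected_refl M w : connected M w w.
Proof.
by exists [::]; split=> [//||p]; [rewrite subrr big_nil | case: p].
Qed.

Lemma connected_step M v w u :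
  is_move M v -> nonneg (w - v) -> connected M (w - v) u -> connected M w u.
Proof.
move=> Mv w_v [vs [Mvs sum_vs vs_ge0]]; exists (v :: vs); split.
- by move=> y; rewrite inE => /predU1P[->|/Mvs].
- by rewrite big_cons -sum_vs [w - v - u]addrAC [v + _]addrC subrK.
case=> // p /=; rewrite big_cons opprD addrA ltnS => le_p.
case: p le_p => [_|p le_p]; first by rewrite take0 big_nil subr0.
exact: vs_ge0.
Qed.

(** Induction on the length of a path, in a form that hides the list of
    moves. *)
Lemma connected_ind M (R : 'cV[int]_n -> 'cV[int]_n -> Prop) :
    (forall w, R w w) ->
    (forall v w u, is_move M v -> nonneg w -> nonneg (w - v) ->
       R (w - v) u -> R w u) ->
  forall w u, nonneg w -> connected M w u -> R w u.
Proof.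
move=> Rrefl Rstep w u w0 [vs []].
elim: vs w w0 => [|v vs IHvs] w w0 Mvs sum_vs vs_ge0.
  by move/eqP: sum_vs; rewrite big_nil subr_eq0 => /eqP->.
have w_v : nonneg (w - v).
  by have := vs_ge0 1%N isT; rewrite /= take0 big_seq1.
apply: (Rstep v) => //; first by apply: Mvs; rewrite inE eqxx.
apply: IHvs => // [y vs_y||p /andP[_ le_p]].
- by apply: Mvs; rewrite inE vs_y orbT.
- by rewrite addrAC sum_vs big_cons addrC addKr.
by have := vs_ge0 p.+1 le_p; rewrite /= big_cons opprD addrA.
Qed.

Lemma connected_trans M w u x :
  nonneg w -> connected M w u -> connected M u x -> connected M w x.
Proof.
move: w u; apply: connected_ind => [//|v w u Mv _ w_v IH ux].
by apply: connected_step Mv w_v _; apply: IH.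
Qed.

Lemma connected_shift M w u x :
  nonneg x -> nonneg w -> connected M w u -> connected M (w + x) (u + x).
Proof.
move=> x0; move: w u; apply: connected_ind => [w|v w u Mv _ w_v IH].
  exact: connected_refl.
by apply: connected_step Mv _ _; rewrite addrAC //; apply: nonneg_add.
Qed.

(** A Markov basis may contain [0], so the moves that stay at [w] are skipped. *)
Lemma connected_first_move M w u :
    nonneg w -> connected M w u -> w != u ->
  exists v, [/\ is_move M v, v != 0 & nonneg (w - v)].
Proof.
move: w u; apply: connected_ind => [w|v w u Mv w0 w_v IH neq_wu].
  by rewrite eqxx.
have [v0|] := eqVneq v 0; last by exists v.
by move: IH; rewrite v0 subr0; apply.
Qed.

(** * Existence of minimal Markov bases *)

(** Dickson's lemma applied to the pairs [(w, u)] of distinct congruent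
    nonnegative vectors gives finitely many pairs [(a, b)] below all others;
    their differences form a Markov basis.  Indeed, if [(a, b)] is below
    [(w, u)], the pair [(w - a, u - b)] has a smaller coordinate sum, because
    [a] and [b] differ and so are not both zero.  It is therefore connected by
    induction, and shifting that path by [b] connects [w - (a - b)] to [u]. *)
Lemma markov_basis_exists : exists M, markov_basis A M.
Proof.
pose P (p : 'cV[int]_n * 'cV[int]_n) :=
  [/\ nonneg p.1, nonneg p.2, p.1 - p.2 \in lattice A & p.1 != p.2].
pose c (i : 'I_n + 'I_n) (p : 'cV[int]_n * 'cV[int]_n) : nat :=
  match i with inl j => `|p.1 j 0%R|%N | inr j => `|p.2 j 0%R|%N end.
have [F [FP Fdom]] := dickson c (enum {: 'I_n + 'I_n}) P.
pose M : {fset 'cV[int]_n} := seq_fset tt [seq p.1 - p.2 | p <- F].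
exists M; split=> [v|w u w0 u0 wu].
  by rewrite seq_fsetE => /mapP[p /FP[_ _ ? _] ->].
pose size2 w u : int := \sum_i (w i 0 + u i 0).
have size2_ge0 w' u' : nonneg w' -> nonneg u' -> 0 <= size2 w' u'.
  by move=> w'0 u'0; apply: sumr_ge0 => i _; rewrite addr_ge0.
suff: forall N w u, nonneg w -> nonneg u -> w - u \in lattice A ->
    size2 w u < N%:Z -> connected M w u.
  move=> conn; apply: (conn (absz (size2 w u)).+1) => //.
  by have := size2_ge0 _ _ w0 u0; lia.
elim=> [|N IHN] {w0 u0 wu}w {}u w0 u0 wu lt_size.
  by have := size2_ge0 _ _ w0 u0; lia.
have [->|neq_wu] := eqVneq w u; first exact: connected_refl.
have [[a b] Fab le_c] : exists2 p : 'cV[int]_n * 'cV[int]_n, p \in F &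
    forall i, i \in enum {: 'I_n + 'I_n} -> (c i p <= c i (w, u))%N.
  by apply: Fdom.
have [/= a0 b0 ab neq_ab] := FP _ Fab.
have w_a : nonneg (w - a).
  move=> i; have := le_c (inl i); rewrite mem_enum /= => /(_ isT).
  by rewrite !coordE; have := w0 i; have := a0 i; lia.
have u_b : nonneg (u - b).
  move=> i; have := le_c (inr i); rewrite mem_enum /= => /(_ isT).
  by rewrite !coordE; have := u0 i; have := b0 i; lia.
have size_ab : 0 < size2 a b.
  rewrite lt0r size2_ge0 // andbT.
  apply: contra neq_ab; rewrite psumr_eq0 => [/allP ab0|i _]; last first.
    by rewrite addr_ge0.
  apply/eqP/coordP=> i.
  have ab_i : a i 0 + b i 0 = 0 by apply/eqP; apply: ab0; apply: mem_index_enum.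
  by have := a0 i; have := b0 i; lia.
have conn_ab : connected M (w - a) (u - b).
  apply: IHN => //.
    have -> : w - a - (u - b) = (w - u) - (a - b).
      by apply/coordP=> i; rewrite !coordE; lia.
    exact: latticeB.
  have size_sub : size2 (w - a) (u - b) = size2 w u - size2 a b.
    by rewrite /size2 -sumrB; apply: eq_bigr => i _; rewrite !coordE; lia.
  by lia.
have w_ab : w - (a - b) = w - a + b by rewrite opprB addrA addrAC.
apply: (@connected_step _ (a - b)).
- by left; rewrite seq_fsetE; apply/mapP; exists (a, b).
- by rewrite w_ab; apply: nonneg_add.
by rewrite w_ab -[u in connected _ _ u](subrK b); apply: connected_shift.
Qed.

Lemma minimal_markov_basis_sub M :
  markov_basis A M -> exists2 M', (M' `<=` M)%fset & minimal_markov_basis A M'.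
Proof.
have [k] := ubnP #|` M|; elim: k M => // k IHk M lt_Mk MM.
case: (classic (exists2 M', (M' `<` M)%fset & markov_basis A M')) => [|noM'].
  case=> M' ltM' /IHk[]; first exact: leq_trans (fproper_ltn_card ltM') _.
  move=> M'' sM'' minM''; exists M'' => //.
  exact: fsubset_trans sM'' (fproper_sub ltM').
by exists M => //; split=> // M' ltM' MM'; apply: noM'; exists M'.
Qed.

(** To check that a set is a Markov basis, it is enough to simulate the moves
    of a known one. *)
Lemma markov_basis_replace M M' :
    markov_basis A M -> {subset M' <= lattice A} ->
    (forall v x, is_move M v -> nonneg x -> nonneg (x - v) ->
       connected M' x (x - v)) ->
  markov_basis A M'.
Proof.
move=> [_ MM] LM' MM'; split=> // w u w0 u0 /(MM _ _ w0 u0).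
rewrite -/(connected M' w u); move: w u w0 {u0}.
apply: connected_ind => [w|v w u Mv w0 w_v]; first exact: connected_refl.
by apply: connected_trans => //; apply: MM'.
Qed.

(** * Indispensable vectors *)

(** A minimal basis can be found inside [M], so a single Markov basis avoiding
    [u] up to sign, minimal or not, refutes the indispensability of [u]. *)
Lemma indispensable_is_move u M :
  indispensable A u -> markov_basis A M -> is_move M u.
Proof.
move=> indisp /minimal_markov_basis_sub[M' /fsubsetP sM' /indisp[]/sM' ?].
  by left.
by right.
Qed.

(** Where [v] is positive, [w] is nonnegative, hence [v] is at most [u];
    elsewhere subtracting [v] cannot make a coordinate negative. *)
Lemma semiconformal_detour u v w x :
  semiconformal_decomp A u v w -> nonneg x -> nonneg (x - u) -> nonneg (x - v).
Proof.
move=> [_ _ _ -> sc] x0 x_u i; have [sci _] := sc i.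
by have := x0 i; have := x_u i; rewrite !coordE; lia.
Qed.

End MarkovBasisTheory.

Theorem proposition1p1 (m n : nat) (A : 'M[nat]_(m, n))
  (pointed : forall u : 'cV[int]_n,
     (u \in lattice A /\ nonneg u) <-> u = 0) :
  forall u : 'cV[int]_n,
    indispensable A u <->
    [/\ u \in lattice A, u != 0 & ~ has_proper_semiconformal_decomp A u].
Proof.
move=> u; split=> [indisp|[Lu u_neq0 no_sc] M [[LM MM] _]]; last first.
  pose up : 'cV[int]_n := \col_i Num.max (u i 0) 0.
  pose um : 'cV[int]_n := \col_i Num.max (- u i 0) 0.
  have upE i : up i 0 = Num.max (u i 0) 0 by rewrite mxE.
  have umE i : um i 0 = Num.max (- u i 0) 0 by rewrite mxE.
  have up0 : nonneg up by move=> i; rewrite upE; lia.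
  have um0 : nonneg um by move=> i; rewrite umE; lia.
  have u_parts : up - um = u.
    by apply/coordP=> i; rewrite !coordE upE umE; lia.
  have neq_parts : up != um by rewrite -subr_eq0 u_parts.
  have conn : connected M up um by apply: MM; rewrite ?u_parts.
  have [v [Mv v_neq0 up_v]] := connected_first_move up0 conn neq_parts.
  have Lv : v \in lattice A.
    by case: Mv => /LM //; rewrite latticeN.
  have [vu|neq_vu] := eqVneq (u - v) 0.
    by move/eqP: vu; rewrite subr_eq0 => /eqP->.
  case: no_sc; exists v, (u - v); split=> //; split=> //.
  - exact: latticeB.
  - by rewrite addrC subrK.
  (* Where [v] is positive, so is the positive part of [u], which then equals
     [u] and is at least [v]. *)
  by move=> i; have := up_v i; rewrite !coordE upE; lia.
have [M MM] := markov_basis_exists A; have [LM _] := MM.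
split.
- by case: (indispensable_is_move indisp MM) => /LM //; rewrite latticeN.
- apply/eqP=> u0.
  suff /(indispensable_is_move indisp): markov_basis A (M `\ u)%fset.
    by rewrite /is_move u0 oppr0 !inE eqxx; case.
  apply: (markov_basis_replace MM) => [v|v x Mv x0 x_v].
    by rewrite !inE => /andP[_ /LM].
  have [->|v_neq0] := eqVneq v 0; first by rewrite subr0; apply: connected_refl.
  apply: (@connected_step _ _ v) x_v _; last exact: connected_refl.
  by rewrite /is_move !inE u0 oppr_eq0 v_neq0.
case=> v [w [sc v_neq0 w_neq0]]; have [Lu Lv Lw uE sc_i] := sc.
have nonneg_eq0 y : y \in lattice A -> nonneg y -> y = 0.
  by move=> Ly y0; apply/pointed.
have neq_uv : u != v.
  by apply: contra w_neq0; rewrite uE -subr_eq0 addrAC subrr add0r.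
have neq_uw : u != w by apply: contra v_neq0; rewrite uE -subr_eq0 addrK.
(* If [v = - u] then [w = 2 u], and semiconformality forces [u] to be
   nonnegative. *)
have neq_uNv : - u != v.
  apply: contra v_neq0 => /eqP vE; rewrite -vE oppr_eq0; apply/eqP.
  apply: nonneg_eq0 => // i; move/coordP/(_ i): vE; move/coordP/(_ i): uE.
  by have := sc_i i; rewrite !coordE; lia.
(* If [w = - u] then [v = 2 u], and semiconformality forces [- u] to be
   nonnegative. *)
have neq_uNw : - u != w.
  apply: contra w_neq0 => /eqP wE; rewrite -wE; apply/eqP.
  apply: nonneg_eq0 => [|i]; first by rewrite latticeN.
  move/coordP/(_ i): wE; move/coordP/(_ i): uE.
  by have := sc_i i; rewrite !coordE; lia.
pose M' := (v |` (w |` (M `\ u `\ - u)))%fset.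
suff /(indispensable_is_move indisp): markov_basis A M'.
  rewrite /is_move !inE (negPf neq_uv) (negPf neq_uw) (negPf neq_uNv).
  by rewrite (negPf neq_uNw) !eqxx /= andbF; case.
have M'v : v \in M' by rewrite !inE eqxx.
have M'w : w \in M' by rewrite !inE eqxx orbT.
apply: (markov_basis_replace MM) => [y|y x My x0 x_y].
  by rewrite !inE => /or3P[/eqP->|/eqP->|/and3P[_ _ /LM]].
have [yu|neq_yu] := eqVneq y u.
  move: x_y; rewrite yu => x_u.
  have x_vw : x - u = x - v - w by rewrite uE opprD addrA.
  apply: (connected_step (or_introl M'v)).
    exact: semiconformal_detour sc x0 x_u.
  apply: (connected_step (or_introl M'w)); rewrite -x_vw //.
  exact: connected_refl.
have [yu|neq_yNu] := eqVneq y (- u).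
  (* The detour of the move [u] from [x + u], travelled backwards. *)
  move: x_y; rewrite yu opprK => xu.
  have xw : x + u - v = x + w by rewrite uE addrA addrAC addrK.
  apply: (@connected_step _ _ (- w)); rewrite ?opprK.
  - by right; rewrite opprK.
  - by rewrite -xw; apply: semiconformal_detour sc xu _; rewrite addrK.
  apply: (@connected_step _ _ (- v)); rewrite ?opprK.
  - by right; rewrite opprK.
  - by rewrite -addrA [w + v]addrC -uE.
  by rewrite -addrA [w + v]addrC -uE; apply: connected_refl.
apply: (@connected_step _ _ y) x_y _; last exact: connected_refl.
have neq_Nyu : - y != u by rewrite eqr_oppLR.
have neq_NyNu : - y != - u by rewrite eqr_opp.
rewrite /is_move !inE neq_yu neq_yNu neq_Nyu neq_NyNu /=.
by case: My => ->; rewrite ?orbT; [left | right].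
Qed.
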